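(* Let $p$ be an odd prime and let $\lambda\in\mathbb{C}_p$ with $|\lambda|_p<p^{-\frac{1}{p-1}}$. For all positive integers $n,k$, $$\frac{2^k}{\binom{n+k}{n}}B_{k,n+k}(x|\lambda)=(x)_{k,\lambda}\sum_{l=0}^{k}\binom{k}{l}\mathcal{E}^{(k)}_{n,\lambda}(1-x+l).$$
   Context: $\mathbb{C}_p$ is the completion of the algebraic closure of $\mathbb{Q}_p$, with $|p|_p=1/p$. For $x\in\mathbb{C}_p$ define $(x)_{0,\lambda}=1$ and $(x)_{n,\lambda}=x(x-\lambda)\cdots(x-(n-1)\lambda)$ for $n\ge1$. For $k\in\mathbb{N}$ the higher-order degenerate Euler polynomials are defined by $$\left(\frac{2}{(1+\lambda t)^{1/\lambda}+1}\right)^k(1+\lambda t)^{x/\lambda}=\sum_{n=0}^\infty\mathcal{E}^{(k)}_{n,\lambda}(x)\frac{t^n}{n!}.$$ The degenerate Bernstein polynomials are $B_{k,n}(x|\lambda)=\binom{n}{k}(x)_{k,\lambda}(1-x)_{n-k,\lambda}$ for integers $n\ge k\ge0$, and $0$ if $n<k$. *)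

(* Defs.v *)
From mathcomp Require Import all_boot all_order all_algebra.
From mathcomp Require Import classical_sets reals topology normedtype sequences.
From mathcomp Require Import exp.

Set Implicit Arguments.
Unset Strict Implicit.
Unset Printing Implicit Defensive.

Import Order.TTheory GRing.Theory Num.Theory.
Import numFieldNormedType.Exports.

Local Open Scope classical_set_scope.
Local Open Scope ring_scope.

Section ComplexPAdicNumbers.
Context {R : realType} {K : fieldType}.
Implicit Types (abs : K -> R) (A : set K) (u : nat -> K).

Definition abs_closure abs A : set K :=
  [set x | forall e : R, 0 < e -> exists2 y, A y & abs (x - y) < e].

Definition abs_cauchy abs u : Prop :=
  forall e : R, 0 < e -> exists N : nat, forall m n : nat,
    (N <= m)%N -> (N <= n)%N -> abs (u m - u n) < e.

Definition abs_complete abs : Prop :=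
  forall u, abs_cauchy abs u ->
    exists l : K, abs (u n - l) @[n --> \oo] --> (0 : R).

Definition algebraic_over A : set K :=
  [set x | exists P : {poly K},
     [/\ P != 0, (forall i, A P`_i) & root P x]].

Definition alg_closed_set A : Prop :=
  forall P : {poly K}, (1 < size P)%N -> (forall i, A P`_i) ->
    exists2 x, A x & root P x.

Record nonarch_abs abs : Prop := NonarchAbs {
  abs_ge0 : forall x, 0 <= abs x;
  abs_eq0 : forall x, abs x = 0 <-> x = 0;
  absM : forall x y, abs (x * y) = abs x * abs y;
  abs_ultra : forall x y, abs (x + y) <= Num.max (abs x) (abs y) }.

(* When K is complete and |p| = 1/p, abs restricts to the p-adic absolute
   value on rat, so the closure of rat in K is a completion of it: this is
   Q_p. The field K has characteristic 0 by is_Cp below, hence ratr is the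
   embedding of rat. *)
Definition Qp_in abs : set K :=
  abs_closure abs (range (ratr : rat -> K)).

Definition Qpbar_in abs : set K := algebraic_over (Qp_in abs).

(* (K, abs) is the completion of an algebraic closure of Q_p, with
   |p| = 1/p. This determines (K, abs) up to isometric isomorphism. *)
Record is_Cp (p : nat) abs : Prop := IsCp {
  Cp_abs : nonarch_abs abs;
  Cp_absp : abs p%:R = p%:R^-1;
  Cp_complete : abs_complete abs;
  Cp_Qpbar_closed : alg_closed_set (Qpbar_in abs);
  Cp_Qpbar_dense : abs_closure abs (Qpbar_in abs) = setT }.

End ComplexPAdicNumbers.

(* A formal power series in t is the sequence of its coefficients; its
   product is the Cauchy product, not the pointwise product of functions. *)
Section FormalPowerSeries.
Context {K : fieldType}.
Implicit Types (f g : nat -> K) (c : K).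

Definition fps_const c : nat -> K := fun n => if n == 0%N then c else 0.

Definition fps_add f g : nat -> K := fun n => f n + g n.

Definition fps_mul f g : nat -> K :=
  fun n => \sum_(i < n.+1) f i * g (n - i)%N.

Definition fps_exp f (k : nat) : nat -> K := iter k (fps_mul f) (fps_const 1).

(* The first n coefficients of 1 / f, by solving f * g = 1 degree by degree. *)
Fixpoint fps_inv_seq f (n : nat) : seq K :=
  if n is m.+1 then
    let s := fps_inv_seq f m in
    rcons s ((f 0%N)^-1 *
             ((m == 0%N)%:R - \sum_(j < m) f (m - j)%N * s`_j))
  else [::].

Definition fps_inv f : nat -> K := fun n => (fps_inv_seq f n.+1)`_n.

Lemma size_fps_inv_seq f n : size (fps_inv_seq f n) = n.
Proof. by elim: n => //= n IHn; rewrite size_rcons IHn. Qed.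

Lemma nth_fps_inv_seq f n i : (i < n)%N -> (fps_inv_seq f n)`_i = fps_inv f i.
Proof.
elim: n => // n IHn; rewrite ltnS leq_eqVlt => /orP[/eqP-> //|lt_in].
by rewrite /= nth_rcons size_fps_inv_seq lt_in IHn.
Qed.

Lemma fps_mulfV f : f 0%N != 0 -> fps_mul f (fps_inv f) =1 fps_const 1.
Proof.
move=> f0 n; rewrite /fps_mul (reindex_inj rev_ord_inj) /= big_ord_recr /=.
rewrite subSS subnn subn0 [X in _ + f _ * X]/fps_inv /= nth_rcons.
rewrite size_fps_inv_seq ltnn eqxx mulrA divff // mul1r.
rewrite (eq_bigr (fun j : 'I_n => f (n - j)%N * (fps_inv_seq f n)`_j)).
  by rewrite addrC subrK /fps_const; case: (n == 0%N).
move=> j _; rewrite nth_fps_inv_seq // subSS; congr (_ * fps_inv f _).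
by rewrite subKn // ltnW.
Qed.

End FormalPowerSeries.

Section DegenerateEulerBernstein.
Context {K : fieldType}.
Implicit Types (lam a x : K) (n k : nat).

Definition deg_ffact lam x n : K := \prod_(i < n) (x - i%:R * lam).

Definition gbinom a n : K := (\prod_(i < n) (a - i%:R)) / n`!%:R.

Definition binomial_series lam a : nat -> K := fun n => gbinom a n * lam ^+ n.

(* (1 + lam t)^(x / lam), which is read as its limit e^(x t) if lam = 0. *)
Definition deg_exp lam x : nat -> K :=
  if lam == 0 then fun n => x ^+ n / n`!%:R
  else binomial_series lam (x / lam).

Definition deg_euler_gf lam k x : nat -> K :=
  fps_mul
    (fps_exp (fps_mul (fps_const 2)
                      (fps_inv (fps_add (deg_exp lam 1) (fps_const 1)))) k)
    (deg_exp lam x).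

Definition deg_euler lam k n x : K := n`!%:R * deg_euler_gf lam k x n.

Definition deg_bernstein lam k n x : K :=
  if (k <= n)%N then
    'C(n, k)%:R * deg_ffact lam x k * deg_ffact lam (1 - x) (n - k)
  else 0.

End DegenerateEulerBernstein.

(* Main.v *)
(** Writing [e^x] for [(1 + lam t)^(x / lam)], the sum on the right has generating
   function [(2 / (e + 1))^k * e^(1 - x) * \sum_l 'C(k, l) e^l], which is
   [2^k * e^(1 - x)] by the binomial theorem; its coefficients are
   [2^k (1 - x)_{n, lam} / n!]. The [p]-adic hypotheses matter only through
   characteristic [0]. *)
Require Import Defs.
From mathcomp Require Import all_boot all_order all_algebra.
From mathcomp Require Import classical_sets reals topology normedtype sequences.
From mathcomp Require Import exp.
From mathcomp Require Import ring.

Set Implicit Arguments.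
Unset Strict Implicit.
Unset Printing Implicit Defensive.

Import Order.TTheory GRing.Theory Num.Theory.

Local Open Scope ring_scope.

(* In characteristic [q], Fermat gives [p ^+ q = p], impossible when
   [0 < abs p < 1]. *)
Lemma is_Cp_pchar0 (R : realType) (p : nat) (Cp : fieldType) (abs : Cp -> R) :
  prime p -> is_Cp p abs -> [pchar Cp] =i pred0.
Proof.
move=> p_prime [[_ _ absM _] absp _ _ _] q; apply/negbTE/negP => charq.
have abs_p_gt0 : 0 < abs p%:R by rewrite absp invr_gt0 ltr0n prime_gt0.
have abs_p_lt1 : abs p%:R < 1 by rewrite absp invf_lt1 ?ltr0n ?ltr1n ?prime_gt0 ?prime_gt1.
have absX m (y : Cp) : abs (y ^+ m.+1) = abs y ^+ m.+1.
  by elim: m => // m IHm; rewrite exprS absM IHm -exprS.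
have: abs (p%:R ^+ q) = abs p%:R by rewrite -(pFrobenius_autE charq) pFrobenius_aut_nat.
have := pcharf_prime charq; case: (q) => [|[|m]] // _.
rewrite absX exprS => /eqP; rewrite -subr_eq0 -[X in _ - X]mulr1 -mulrBr.
rewrite mulf_eq0 gt_eqF //= subr_eq0 pexpr_eq1 ?ltW //.
by rewrite lt_eqF.
Qed.

Section FpsModPoly.
Context {K : fieldType}.
Implicit Types (f g : nat -> K) (P Q : {poly K}) (N : nat).

(** Bridge from bare coefficient functions to the commutative ring [{poly K}], where the binomial
    theorem applies. Truncation is harmless: coefficients of a product up to degree [N] depend only
    on those of the factors up to degree [N]. *)
Definition fps_eqmod N f P := forall i, (i <= N)%N -> f i = P`_i.

Lemma fps_eqmod_poly N f : fps_eqmod N f (\poly_(i < N.+1) f i).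
Proof. by move=> i iN; rewrite coef_poly ltnS iN. Qed.

Lemma fps_eqmod_const N (c : K) : fps_eqmod N (fps_const c) c%:P.
Proof. by move=> i _; rewrite coefC. Qed.

Lemma fps_eqmod_add N f g P Q :
  fps_eqmod N f P -> fps_eqmod N g Q -> fps_eqmod N (fps_add f g) (P + Q).
Proof. by move=> fP gQ i iN; rewrite coefD /fps_add fP ?gQ. Qed.

Lemma fps_eqmod_mul N f g P Q :
  fps_eqmod N f P -> fps_eqmod N g Q -> fps_eqmod N (fps_mul f g) (P * Q).
Proof.
move=> fP gQ i iN; rewrite coefM /fps_mul; apply: eq_bigr => j _.
rewrite fP ?gQ //; first exact: leq_trans (leq_subr _ _) iN.
by apply: leq_trans iN; rewrite -ltnS.
Qed.

Lemma fps_eqmod_exp N f P k :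
  fps_eqmod N f P -> fps_eqmod N (fps_exp f k) (P ^+ k).
Proof.
move=> fP; elim: k => [|k IHk]; first exact: fps_eqmod_const.
by rewrite exprS; apply: fps_eqmod_mul.
Qed.

End FpsModPoly.

Section DegenerateExponential.
Context {K : fieldType} (char0 : [pchar K] =i pred0) (lam : K).
Implicit Types (x y : K) (n : nat).

Let natS_neq0 n : n.+1%:R != 0 :> K.
Proof. by rewrite ((pcharf0P K).1 char0). Qed.

Lemma fact_neq0 n : n`!%:R != 0 :> K.
Proof. by rewrite ((pcharf0P K).1 char0) -lt0n fact_gt0. Qed.

(** For nonzero [lam], each of the [n] factors [x / lam - i] absorbs one factor of [lam ^+ n]; for
    [lam = 0] every factor is already [x]. Later arguments thus need no case split on [lam]. *)
Lemma deg_expE x n : deg_exp lam x n = deg_ffact lam x n / n`!%:R.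
Proof.
rewrite /deg_exp /deg_ffact; case: eqP => [->|/eqP lam0].
  by congr (_ / _); under eq_bigr do rewrite mulr0 subr0; rewrite prodr_const card_ord.
rewrite /binomial_series /gbinom mulrAC; congr (_ / _).
rewrite -[X in _ * lam ^+ X]card_ord -prodr_const -big_split /=.
by apply: eq_bigr => i _; rewrite mulrBl divfK.
Qed.

Lemma deg_exp0 x : deg_exp lam x 0 = 1.
Proof. by rewrite deg_expE /deg_ffact big_ord0 divr1. Qed.

(** Coefficient form of the differential equation [(1 + lam t) y' = x y]. *)
Lemma deg_expS x n :
  n.+1%:R * deg_exp lam x n.+1 = (x - n%:R * lam) * deg_exp lam x n.
Proof.
rewrite !deg_expE /deg_ffact big_ord_recr /= factS natrM.
by field; rewrite fact_neq0 addrC natr1 natS_neq0.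
Qed.

(* Both sides satisfy the recurrence of [deg_expS]. *)
Lemma deg_expD x y :
  fps_mul (deg_exp lam x) (deg_exp lam y) =1 deg_exp lam (x + y).
Proof.
elim=> [|n IHn]; first by rewrite /fps_mul big_ord1 !deg_exp0 mulr1.
apply: (mulfI (natS_neq0 n)); rewrite deg_expS -IHn /fps_mul !big_distrr /=.
set a := deg_exp lam x; set b := deg_exp lam y.
(* Leibniz rule: the factor [n.+1] is split as [i + (n.+1 - i)]. *)
transitivity (\sum_(i < n.+2) (i%:R * a i) * b (n.+1 - i)%N
            + \sum_(i < n.+2) a i * ((n.+1 - i)%:R * b (n.+1 - i)%N)).
  rewrite -big_split /=; apply: eq_bigr => i _.
  by rewrite natrB -1?ltnS //; ring.
(* The first term of one sum and the last of the other vanish. After a shift of index both run over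
   [i < n.+1], and the recurrence factors add up: [(x - i lam) + (y - (n - i) lam) = x + y - n
   lam]. *)
rewrite big_ord_recl mul0r mul0r add0r [X in _ + X]big_ord_recr /=.
rewrite subnn mul0r mulr0 addr0 -big_split /=; apply: eq_bigr => i _.
have le_in : (i <= n)%N by rewrite -ltnS.
rewrite /bump leq0n add1n subSS [X in X * _ + _]deg_expS subSn // [X in _ + _ * X]deg_expS.
by rewrite natrB // -/a -/b; ring.
Qed.

(** Makes all the shifts by [l] powers of a single polynomial [Q], as the binomial theorem
    requires. *)
Lemma fps_eqmod_deg_exp_nat N x l P Q :
  fps_eqmod N (deg_exp lam x) P -> fps_eqmod N (deg_exp lam 1) Q ->
  fps_eqmod N (deg_exp lam (x + l%:R)) (P * Q ^+ l).
Proof.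
move=> xP oneQ; elim: l => [|l IHl]; first by rewrite addr0 expr0 mulr1.
move=> i iN; rewrite -natr1 addrA -deg_expD exprSr mulrA.
exact: fps_eqmod_mul iN.
Qed.

Lemma sum_deg_euler k n x :
  \sum_(l < k.+1) 'C(k, l)%:R * deg_euler lam k n (x + l%:R) =
  2 ^+ k * deg_ffact lam x n.
Proof.
set e1 := fps_add (deg_exp lam 1) (fps_const 1).
set E := \poly_(i < n.+1) deg_exp lam 1 i.
set X := \poly_(i < n.+1) deg_exp lam x i.
set A := \poly_(i < n.+1) fps_inv e1 i.
have EP : fps_eqmod n (deg_exp lam 1) E by exact: fps_eqmod_poly.
have XP : fps_eqmod n (deg_exp lam x) X by exact: fps_eqmod_poly.
have AP : fps_eqmod n (fps_inv e1) A by exact: fps_eqmod_poly.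
have e1P : fps_eqmod n e1 (E + 1).
  by rewrite -polyC1; exact: fps_eqmod_add EP (fps_eqmod_const _).
(* The constant coefficient is [1 + 1], nonzero in characteristic 0. *)
have e1_neq0 : e1 0%N != 0 by rewrite /e1 /fps_add deg_exp0 (natS_neq0 1).
pose G := 2%:P * A.
have GP : fps_eqmod n (fps_mul (fps_const 2) (fps_inv e1)) G.
  exact: fps_eqmod_mul (fps_eqmod_const _) AP.
have invP : fps_eqmod n (fps_const 1) ((E + 1) * A).
  by move=> i iN; rewrite -(fps_mulfV e1_neq0); apply: fps_eqmod_mul iN.
(* [G * (E + 1)] and the constant 2 may differ in degrees above [n], so they are not equated as
   polynomials: both are compared with the same series. *)
have twoP : fps_eqmod n (fps_mul (fps_const 2) (fps_const 1)) (G * (E + 1)).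
  rewrite /G -mulrA [A * _]mulrC; exact: fps_eqmod_mul (fps_eqmod_const _) invP.
have twoQ : fps_eqmod n (fps_mul (fps_const 2) (fps_const 1)) ((2 : K)%:P * 1%:P).
  exact: fps_eqmod_mul (fps_eqmod_const _) (fps_eqmod_const _).
transitivity (n`!%:R * ((G * (E + 1)) ^+ k * X)`_n).
  have -> : (G * (E + 1)) ^+ k * X
      = \sum_(l < k.+1) (G ^+ k * (X * E ^+ l)) *+ 'C(k, l).
    rewrite exprMn addrC exprDn mulrAC big_distrr /=; apply: eq_bigr => l _.
    by rewrite expr1n mul1r mulrnAr mulrA.
  rewrite coef_sum big_distrr /=; apply: eq_bigr => l _.
  rewrite coefMn /deg_euler mulrCA; congr (_ * _); rewrite mulr_natl; congr (_ *+ _).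
  apply: fps_eqmod_mul (leqnn n); first exact: fps_eqmod_exp.
  exact: fps_eqmod_deg_exp_nat.
(* Passing through the common series replaces [G * (E + 1)] by 2 inside the coefficient of degree
   [n]. *)
rewrite -(fps_eqmod_mul (fps_eqmod_exp k twoP) XP (leqnn n)).
rewrite (fps_eqmod_mul (fps_eqmod_exp k twoQ) XP (leqnn n)).
rewrite mulr1 -polyC_exp coefCM -XP // deg_expE.
by field; rewrite fact_neq0.
Qed.

End DegenerateExponential.

Theorem theorem2p6 (R : realType) (p : nat) (p_prime : prime p) (p_odd : odd p)
    (Cp : fieldType) (abs : Cp -> R) (hCp : is_Cp p abs)
    (lam : Cp) (hlam : abs lam < p%:R `^ (- (1 / (p%:R - 1))))
    (n k : nat) (hn : (0 < n)%N) (hk : (0 < k)%N) (x : Cp) :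
  2 ^+ k / 'C(n + k, n)%:R * deg_bernstein lam k (n + k) x =
  deg_ffact lam x k *
    \sum_(l < k.+1) 'C(k, l)%:R * deg_euler lam k n (1 - x + l%:R).
Proof.
have char0 := is_Cp_pchar0 p_prime hCp.
rewrite (sum_deg_euler char0) /deg_bernstein leq_addl addnK.
have -> : 'C(n + k, k) = 'C(n + k, n) by rewrite -[RHS]bin_sub ?leq_addr // addKn.
have bin_neq0 : 'C(n + k, n)%:R != 0 :> Cp.
  by rewrite ((pcharf0P Cp).1 char0) -lt0n bin_gt0 leq_addr.
by field.
Qed.
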